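(* Let $X$ and $Y$ be non-negative random variables with distributions $F$ and $G$ respectively, with support $\mathbb{R}_+=[0,\infty)$. Assume that there exists a constant $C>0$ such that $$\mathbf{P}[X>x,\;Y>y]\sim C\,\overline F(x)\,\overline G(y),\qquad (x,y)\to(\infty,\infty).$$ Let $F_{X\wedge Y}$ denote the distribution of $X\wedge Y=\min\{X,Y\}$. Then: 1. If $F\in\mathcal{P_D}$ and $G\in\mathcal{P_D}$, then $F_{X\wedge Y}\in\mathcal{P_D}$. 2. If $F\in\mathcal{OL}$ and $G\in\mathcal{OL}$, then $F_{X\wedge Y}\in\mathcal{OL}$. 3. If $F\in\mathcal{OT}$ and $G\in\mathcal{OT}$, then $F_{X\wedge Y}\in\mathcal{OT}$. 4. If $F\in\mathcal{L}$ and $G\in\mathcal{L}$, then $F_{X\wedge Y}\in\mathcal{L}$. 5. If $F\in\mathcal{T}$ and $G\in\mathcal{T}$, then $F_{X\wedge Y}\in\mathcal{T}$.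
   Context: For a distribution $F$, $\overline F(x)=1-F(x)$ denotes its tail; $\overline F(x)>0$ and $\overline G(x)>0$ for every $x\ge 0$. The relation $\sim$ means that the ratio of the two sides tends to $1$. Classes of distributions: - $F\in\mathcal{P_D}$ (positively decreasing) if $\limsup_{x\to\infty}\overline F(vx)/\overline F(x)<1$ for some $v>1$. - $F\in\mathcal{OL}$ (generalized long-tailed) if $\limsup_{x\to\infty}\overline F(x-t)/\overline F(x)<\infty$ for every $t\neq 0$. - $F\in\mathcal{L}$ (long-tailed) if $\lim_{x\to\infty}\overline F(x-y)/\overline F(x)=1$ for every $y\ne 0$. - $\mathcal{OT}:=\mathcal{OL}\cap\mathcal{P_D}$ and $\mathcal{T}:=\mathcal{L}\cap\mathcal{P_D}$. *)

(* Defs.v *)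
From HB Require Import structures.
From mathcomp Require Import all_boot all_order all_algebra.
From mathcomp Require Import all_classical all_reals all_analysis.
From mathcomp Require Import measurable_realfun.

Set Implicit Arguments.
Unset Strict Implicit.
Unset Printing Implicit Defensive.

Import Order.TTheory GRing.Theory Num.Theory.
Import numFieldNormedType.Exports.

Local Open Scope classical_set_scope.
Local Open Scope ring_scope.

(* Distributions are Borel probability measures on R; [dfun F] is the
   real-valued distribution function x |-> F(x). *)
Definition dfun (R : realType) (F : probability R R) (x : R) : R :=
  fine (F `]-oo, x]%classic).

Definition tail (R : realType) (F : probability R R) (x : R) : R :=
  1 - dfun F x.

(* Topological support: the points all of whose neighbourhoods are charged. *)
Definition msupport (R : realType) (F : probability R R) : set R :=
  [set x | forall e : R, 0 < e -> (0 < F (ball x e))%E].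

(* Since x / 0 = 0, these classes have their usual meaning only for
   distributions whose tail never vanishes. *)
Definition positively_decreasing (R : realType) (F : probability R R) : Prop :=
  exists2 v : R, 1 < v &
    (limf_esup (fun x : R => (tail F (v * x) / tail F x)%:E) +oo%R < 1)%E.

Definition generalized_long_tailed (R : realType) (F : probability R R) : Prop :=
  forall t : R, t != 0 ->
    (limf_esup (fun x : R => (tail F (x - t) / tail F x)%:E) +oo%R < +oo)%E.

Definition long_tailed (R : realType) (F : probability R R) : Prop :=
  forall y : R, y != 0 ->
    tail F (x - y) / tail F x @[x --> +oo%R] --> (1 : R).

Definition class_OT (R : realType) (F : probability R R) : Prop :=
  generalized_long_tailed F /\ positively_decreasing F.

Definition class_T (R : realType) (F : probability R R) : Prop :=
  long_tailed F /\ positively_decreasing F.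

(* Main.v *)
(* With f, g, h the tails of X, Y and min(X, Y), the assumption on the diagonal
   gives h x = q x * (C * f x * g x) with q --> 1. Hence, for every k --> +oo,
   h (k x) / h x is eventually r x * (f (k x) / f x) * (g (k x) / g x) with
   r --> 1, and each class is read off from this factorization with k x = v * x
   or k x = x - t. *)

Require Import Defs.
From HB Require Import structures.
From mathcomp Require Import all_boot all_order all_algebra.
From mathcomp Require Import all_classical all_reals all_analysis.
From mathcomp Require Import measurable_realfun.
From mathcomp Require Import ring lra.

Set Implicit Arguments.
Unset Strict Implicit.
Unset Printing Implicit Defensive.

Import Order.TTheory GRing.Theory Num.Theory.
Import numFieldNormedType.Exports.

Local Open Scope classical_set_scope.
Local Open Scope ring_scope.

(** The limsup is an infimum of suprema over the sets of [F], so it lies below [a] as soon as one of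
    these suprema does. With [a = 1] and [a = +oo] this turns the limsup conditions of the two
    classes into eventual bounds by a real number. *)
Lemma limf_esup_EFin_lt (T : choiceType) (U : filteredType T) (R : realType)
    (F : set_system U) (FF : ProperFilter F) (f : U -> R) (a : \bar R) :
  (limf_esup (fun x => (f x)%:E) F < a)%E <->
  exists2 b : R, (b%:E < a)%E & \forall x \near F, f x <= b.
Proof.
split=> [/ereal_inf_lt[_ [A FA <-]] sup_lt | [b ba fb]].
  have fA x : A x -> ((f x)%:E <= ereal_sup [set (f x)%:E | x in A])%E.
    by move=> Ax; apply: ereal_sup_ubound; exists x.
  case: ereal_sup sup_lt fA => [b | | ] ba fA.
  - by exists b => //; apply: filterS FA => x /fA; rewrite lee_fin.
  - by move: ba; rewrite ltNge leey.
  (* A supremum equal to [-oo] would force [A] to be empty, which properness of [F] excludes. *)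
  - by have [x /fA] := filter_ex FA.
apply: le_lt_trans ba.
apply: (@le_trans _ _ (ereal_sup [set (f x)%:E | x in [set x | f x <= b]])).
  by apply: ereal_inf_lbound; exists [set x | f x <= b].
by apply: ge_ereal_sup => _ [x /= fx <-]; rewrite lee_fin.
Qed.

Section product_equivalence.
Context {R : realType} (f g h : R -> R) (C : R).
Hypotheses (C_gt0 : 0 < C) (f_gt0 : \forall x \near +oo, 0 < f x)
  (g_gt0 : \forall x \near +oo, 0 < g x)
  (h_fg : h x / (C * f x * g x) @[x --> +oo] --> (1 : R)).

(** With [q] the quotient in [h_fg], the factor [r x] is [q (k x) / q x]: both terms tend to 1 and
    the constant [C] cancels. *)
Lemma ratio_factorization (k : R -> R) : k x @[x --> +oo] --> +oo ->
  exists2 r : R -> R, r x @[x --> +oo] --> (1 : R) &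
    \forall x \near +oo,
      h (k x) / h x = r x * (f (k x) / f x * (g (k x) / g x)).
Proof.
move=> k_pinfty; pose q x := h x / (C * f x * g x).
exists (fun x => q (k x) / q x).
  rewrite -[1]divr1; apply: cvgM; first exact: cvg_comp k_pinfty h_fg.
  by apply: cvgV => //; exact: oner_neq0.
(* Eventual positivity is pulled back along [k], which tends to [+oo]. *)
have fk_gt0 : \forall x \near +oo, 0 < f (k x) by exact: (k_pinfty _ f_gt0).
have gk_gt0 : \forall x \near +oo, 0 < g (k x) by exact: (k_pinfty _ g_gt0).
have q_gt0 : \forall x \near +oo, 0 < q x by apply: (cvgr_gt 1 h_fg); exact: ltr01.
near=> x.
have fx : f x != 0 by apply: lt0r_neq0; near: x.
have gx : g x != 0 by apply: lt0r_neq0; near: x.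
have fkx : f (k x) != 0 by apply: lt0r_neq0; near: x.
have gkx : g (k x) != 0 by apply: lt0r_neq0; near: x.
have Cn0 : C != 0 by exact: lt0r_neq0.
(* Nothing is assumed on the sign of [h]; it cannot vanish where [q x > 0], since [q x] has [h x] as
   numerator. *)
have hx : h x != 0.
  have : q x != 0 by apply: lt0r_neq0; near: x.
  by apply: contra_neq; rewrite /q => ->; rewrite mul0r.
rewrite /q; field.
by rewrite fx gx fkx gkx Cn0 hx.
Unshelve. all: by end_near. Qed.

Lemma bounded_ratio (k : R -> R) (a b : R) : k x @[x --> +oo] --> +oo ->
  (\forall x \near +oo, f (k x) / f x <= a) ->
  (\forall x \near +oo, g (k x) / g x <= b) ->
  \forall x \near +oo, h (k x) / h x <= 2 * (a * b).
Proof.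
move=> k_pinfty fa gb; have [r r1 hE] := ratio_factorization k_pinfty.
have fk_gt0 : \forall x \near +oo, 0 < f (k x) by exact: (k_pinfty _ f_gt0).
have gk_gt0 : \forall x \near +oo, 0 < g (k x) by exact: (k_pinfty _ g_gt0).
(* Any constant above 1, the limit of [r], would do in place of 2. *)
have r_le2 : \forall x \near +oo, r x <= 2.
  by apply: (cvgr_le 1 r1); rewrite ltr1n.
have r_ge0 : \forall x \near +oo, 0 <= r x by apply: (cvgr_ge 1 r1); exact: ltr01.
near=> x.
have fx : 0 <= f (k x) / f x by rewrite divr_ge0// ltW//; near: x.
have gx : 0 <= g (k x) / g x by rewrite divr_ge0// ltW//; near: x.
have hx : h (k x) / h x = r x * (f (k x) / f x * (g (k x) / g x)) by near: x.
rewrite hx; apply: ler_pM.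
- by near: x.
- exact: mulr_ge0.
- by near: x.
- by apply: ler_pM => //; near: x.
Unshelve. all: by end_near. Qed.

(** One ratio strictly below 1 is enough if the other does not exceed 1: the product is then at most
    [r x * a], which tends to [a < 1]. *)
Lemma ratio_lt1 (k : R -> R) (a : R) : k x @[x --> +oo] --> +oo -> a < 1 ->
  (\forall x \near +oo, f (k x) / f x <= a) ->
  (\forall x \near +oo, g (k x) / g x <= 1) ->
  exists2 b : R, b < 1 & \forall x \near +oo, h (k x) / h x <= b.
Proof.
move=> k_pinfty a1 fa gb; have [r r1 hE] := ratio_factorization k_pinfty.
have fk_gt0 : \forall x \near +oo, 0 < f (k x) by exact: (k_pinfty _ f_gt0).
have gk_gt0 : \forall x \near +oo, 0 < g (k x) by exact: (k_pinfty _ g_gt0).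
have r_ge0 : \forall x \near +oo, 0 <= r x by apply: (cvgr_ge 1 r1); exact: ltr01.
(* The midpoint of [a] and 1 leaves room on both sides: it is below 1 and above [a], the limit of
   [r x * a]. *)
exists ((1 + a) / 2); first by lra.
have ra : \forall x \near +oo, r x * a <= (1 + a) / 2.
  apply: (cvgr_le (1 * a)); last by lra.
  by apply: cvgM => //; exact: cvg_cst.
near=> x.
have fx : 0 <= f (k x) / f x by rewrite divr_ge0// ltW//; near: x.
have gx : 0 <= g (k x) / g x by rewrite divr_ge0// ltW//; near: x.
have hx : h (k x) / h x = r x * (f (k x) / f x * (g (k x) / g x)) by near: x.
rewrite hx; apply: (@le_trans _ _ (r x * a)); last by near: x.
apply: ler_wpM2l; first by near: x.
by rewrite -[leRHS]mulr1; apply: ler_pM => //; near: x.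
Unshelve. all: by end_near. Qed.

(** The factorization writes the ratio of [h], eventually, as a product of three functions that all
    tend to 1. *)
Lemma cvg_ratio1 (k : R -> R) : k x @[x --> +oo] --> +oo ->
  f (k x) / f x @[x --> +oo] --> (1 : R) ->
  g (k x) / g x @[x --> +oo] --> (1 : R) ->
  h (k x) / h x @[x --> +oo] --> (1 : R).
Proof.
move=> k_pinfty f1 g1; have [r r1 hE] := ratio_factorization k_pinfty.
have : r x * (f (k x) / f x * (g (k x) / g x)) @[x --> +oo] --> (1 : R).
  by rewrite -[X in _ --> X]mulr1; apply: cvgM => //;
    rewrite -[X in _ --> X]mulr1; exact: cvgM.
apply: cvg_trans; apply: near_eq_cvg.
by apply: filterS hE => x ->.
Qed.

End product_equivalence.

Lemma tail_nonincreasing (R : realType) (F : probability R R) (x y : R) :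
  x <= y -> tail F y <= tail F x.
Proof.
move=> xy; rewrite lerB// /dfun fine_le ?fin_num_measure// le_measure ?inE//.
by apply: subset_itvl; rewrite bnd_simp.
Qed.

Lemma tail_distribution (R : realType) (d : measure_display)
    (T : measurableType d) (P : probability T R) (X : {RV P >-> R}) (x : R) :
  tail (distribution P X) x = fine (P [set w | x < X w]).
Proof.
have -> : [set w | x < X w] = ~` (X @^-1` `]-oo, x]).
  by apply/seteqP; split=> w /=; rewrite in_itv/= ltNge => /negP.
have mX : measurable (X @^-1` `]-oo, x]) by exact: measurable_funPTI.
by rewrite probability_setC// fineB ?fin_num_measure.
Qed.

Theorem theorem2p2 (R : realType) (d : measure_display) (T : measurableType d)
    (P : probability T R) (X Y : {RV P >-> R}) (C : R)
    (X_ge0 : {ae P, forall w, 0 <= X w})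
    (Y_ge0 : {ae P, forall w, 0 <= Y w})
    (supp_X : msupport (distribution P X) = `[0, +oo[%classic)
    (supp_Y : msupport (distribution P Y) = `[0, +oo[%classic)
    (tail_X : forall x : R, 0 <= x -> 0 < tail (distribution P X) x)
    (tail_Y : forall y : R, 0 <= y -> 0 < tail (distribution P Y) y)
    (C_gt0 : 0 < C)
    (joint_tail :
      (fun xy : R * R =>
         fine (P [set w | xy.1 < X w /\ xy.2 < Y w]) /
         (C * tail (distribution P X) xy.1 * tail (distribution P Y) xy.2))
      @ filter_prod (pinfty_nbhs R) (pinfty_nbhs R) --> (1 : R)) :
  [/\ positively_decreasing (distribution P X) ->
      positively_decreasing (distribution P Y) ->
      positively_decreasing (distribution P (X \min Y)),
      generalized_long_tailed (distribution P X) ->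
      generalized_long_tailed (distribution P Y) ->
      generalized_long_tailed (distribution P (X \min Y)),
      class_OT (distribution P X) ->
      class_OT (distribution P Y) ->
      class_OT (distribution P (X \min Y)),
      long_tailed (distribution P X) ->
      long_tailed (distribution P Y) ->
      long_tailed (distribution P (X \min Y))
    & class_T (distribution P X) ->
      class_T (distribution P Y) ->
      class_T (distribution P (X \min Y))].

Proof.
set f := tail (distribution P X); set g := tail (distribution P Y).
pose h := tail (distribution P (X \min Y)).
(* The minimum exceeds [x] exactly when both variables do, so its tail is the joint tail on the
   diagonal. *)
have hE x : h x = fine (P [set w | x < X w /\ x < Y w]).
  rewrite /h tail_distribution; congr (fine (P _)).
  by apply/seteqP; split=> w /=; rewrite lt_min => /andP.
have h_fg : h x / (C * f x * g x) @[x --> +oo] --> (1 : R).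
  under eq_fun do rewrite hE.
  (* The map sending [x] to [(x, x)] tends to the product filter, so the joint limit restricts to
     the diagonal. *)
  exact: cvg_comp (cvg_pair cvg_id cvg_id) joint_tail.
have f_gt0 : \forall x \near +oo, 0 < f x.
  by near=> x; apply: tail_X; near: x; exact: nbhs_pinfty_ge (num_real _).
have g_gt0 : \forall x \near +oo, 0 < g x.
  by near=> x; apply: tail_Y; near: x; exact: nbhs_pinfty_ge (num_real _).
have PD : positively_decreasing (distribution P X) ->
    positively_decreasing (distribution P (X \min Y)).
  (* The scale [v] of [X] is kept for the minimum. At this scale the ratio of [g] is at most 1 by
     monotonicity, because [v * x >= x] once [x >= 0]. *)
  move=> [v v1 /limf_esup_EFin_lt[a a1 fa]]; exists v => //.
  apply/limf_esup_EFin_lt.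
  apply: (ratio_lt1 C_gt0 f_gt0 g_gt0 h_fg _ a1 fa).
    apply: gt0_cvgMry; [exact: lt_trans v1 | exact: cvg_id].
  near=> x; have gx : 0 < g x by near: x.
  have x_ge0 : 0 <= x by near: x; exact: nbhs_pinfty_ge (num_real _).
  by rewrite ler_pdivrMr// mul1r tail_nonincreasing// ler_peMl// ltW.
have OL : generalized_long_tailed (distribution P X) ->
    generalized_long_tailed (distribution P Y) ->
    generalized_long_tailed (distribution P (X \min Y)).
  move=> ft gt t t0.
  have /limf_esup_EFin_lt[a _ fa] := ft t t0.
  have /limf_esup_EFin_lt[b _ gb] := gt t t0.
  (* Here the threshold is [+oo], so any real eventual bound suffices. *)
  apply/limf_esup_EFin_lt; exists (2 * (a * b)); first exact: ltey.
  exact: (bounded_ratio C_gt0 f_gt0 g_gt0 h_fg (cvg_addrr (- t)) fa gb).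
have L : long_tailed (distribution P X) ->
    long_tailed (distribution P Y) ->
    long_tailed (distribution P (X \min Y)).
  move=> ft gt t t0.
  (* The shift [x - t] tends to [+oo] whatever the sign of [t], so it is an admissible [k]. *)
  exact: (cvg_ratio1 C_gt0 f_gt0 g_gt0 h_fg (cvg_addrr (- t)) (ft t t0) (gt t t0)).
split=> //.
- by move=> /PD.
- by move=> [oX /PD pd] [oY _]; split=> //; exact: OL.
- by move=> [lX /PD pd] [lY _]; split=> //; exact: L.
Unshelve. all: by end_near. Qed.
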